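(* Let $b\in\mathbb{N}_0$ and $v,w,z\in(0,1]$, and assume that not both $p_0+p_1=1$ and $v=1$. For $x\in\mathbb{Z}$ put $$DP_v^{b]}(x,w,z):=E_x^{b]}\big[v^{\tilde\tau_{-1}^-}w^{-\tilde X(\tilde\tau_{-1}^-)}z^{R(\tilde\tau_{-1}^-)};\tilde\tau_{-1}^-<\infty\big].$$ Then $$DP_v^{b]}(x,w,z)=\begin{cases}Z_v(x,w)-\dfrac{Z_v(b+1,w)-zZ_v(b,w)}{W_v(b+1)-zW_v(b)}\,W_v(x), & x\le b,\\[2mm] z^{x-b}\,DP_v^{b]}(b,w,z), & x>b.\end{cases}$$
   Context: Notation: $\mathbb{N}=\{1,2,\dots\}$, $\mathbb{N}_0=\{0,1,2,\dots\}$; $E[Y;A]:=E[Y\mathbf{1}_A]$; $\inf\emptyset=\infty$. Let $(p_k)_{k\in\mathbb{N}_0}$ be a probability mass function on $\mathbb{N}_0$ with $p_0>0$, and let $C_1,C_2,\dots$ be i.i.d. with $P(C_1=k)=p_k$. Let $X_n=X_0+n-\sum_{i=1}^nC_i$, $n\in\mathbb{N}_0$; for $x\in\mathbb{Z}$, $P_x$ (expectation $E_x$) is the law under which $X_0=x$, and $P=P_0$, $E=E_0$. For $b\in\mathbb{Z}$ let $\tau_b^-=\inf\{n\in\mathbb{N}_0:X_n\le b\}$ and $\tau_b^+=\inf\{n\in\mathbb{N}_0:X_n\ge b\}$. For $v\in(0,1]$: $W_v(y):=\big(p_0E[v^{\tau_y^+};\tau_y^+<\tau_{-1}^-]\big)^{-1}$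 for $y\in\mathbb{N}_0$, and $W_v(y):=0$ for integers $y<0$. For $v,w\in(0,1]$ and $x\in\mathbb{Z}$: $\Psi_v(x,w):=E_x[v^{\tau_{-1}^-}w^{-X(\tau_{-1}^-)};\tau_{-1}^-<\infty]$ and $Z_v(x,w):=\Psi_v(x,w)+\alpha_v(w)W_v(x)$, where the constant $\alpha_v(w)\in[0,\infty)$ is chosen so that $Z_v(0,w)=1$. Process reflected at $b\in\mathbb{N}_0$ (barrier dividend policy $\pi_b$): with initial capital $x\in\mathbb{Z}$, the dividend $r(0)=\max(x-b,0)$ is paid and $\tilde X_0=x-r(0)$; for $k\in\mathbb{N}$, as long as ruin has not yet occurred, $r(k)=\max(\tilde X_{k-1}+1-C_k-b,0)$ and $\tilde X_k=\tilde X_{k-1}+1-C_k-r(k)$. The ruin time is $\tilde\tau_{-1}^-:=\inf\{k\in\mathbb{N}_0:\tilde X_k<0\}$, after which the process is stopped and no dividends are paid ($r(k)=0$ for $k\ge\tilde\tau_{-1}^-$). $R(k):=\sum_{i=0}^kr(i)$ are the cumulative dividends. $P_x^{b]},E_x^{b]}$ denote probability and expectation for this process with initial capital $x$. *)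

(* Defs.v *)
From HB Require Import structures.
From mathcomp Require Import all_boot all_order all_algebra finmap.
From mathcomp Require Import all_classical all_reals all_analysis.

Set Implicit Arguments.
Unset Strict Implicit.
Unset Printing Implicit Defensive.

Import Order.TTheory GRing.Theory Num.Theory.

Local Open Scope classical_set_scope.
Local Open Scope ring_scope.

Definition is_pmf (R : realType) (p : nat -> R) : Prop :=
  (forall k, 0 <= p k) /\ (\sum_(0 <= k <oo) (p k)%:E = 1)%E.

Definition mutually_independent (R : realType)
    (d d' : measure_display) (T : measurableType d) (T' : measurableType d')
    (P : probability T R) (I : choiceType) (X : I -> {RV P >-> T'}) : Prop :=
  forall (J : {fset I}) (B : I -> set T'), (forall i, measurable (B i)) ->
    P (\bigcap_(i in [set` J]) X i @^-1` B i) =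
      (\prod_(i <- J) P (X i @^-1` B i))%E.

Definition iid_with_pmf (R : realType) (d : measure_display)
    (T : measurableType d) (P : probability T R)
    (C : nat -> {RV P >-> nat}) (p : nat -> R) : Prop :=
  mutually_independent C /\
  (forall i k, P (C i @^-1` [set k]) = (p k)%:E).

(* E[Y; A]; all the expectations below are those of random variables with
   values in [0, 1] on A, so that [fine] loses nothing. *)
Definition expect_on (R : realType) (d : measure_display)
    (T : measurableType d) (P : probability T R) (Y : T -> R) (A : set T) : R :=
  fine 'E_P[Y \* \1_A]%E.

(* inf A in {0, 1, 2, ...} U {oo}, where [None] stands for oo. *)
Definition inf_time (A : pred nat) : option nat :=
  if pselect (exists n, A n) is left exA then Some (ex_minn exA) else None.

Definition lt_time (s t : option nat) : bool :=
  match s, t with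
  | Some m, Some n => (m < n)%N
  | Some _, None => true
  | None, _ => false
  end.

(* For a process Y and a time s, Y(s); only used on the event s < oo. *)
Definition at_time (S : Type) (Y : nat -> S) (s : option nat) : S :=
  Y (odflt 0%N s).

(* v^s; only used on the event s < oo. *)
Definition pow_time (R : realType) (v : R) (s : option nat) : R :=
  v ^+ odflt 0%N s.

Definition hit_below (Y : nat -> int) (b : int) : option nat :=
  inf_time (fun n => Y n <= b).

Definition hit_above (Y : nat -> int) (b : int) : option nat :=
  inf_time (fun n => b <= Y n).

(* Claims are numbered from 0: [c i] is the claim C_{i+1} of period i + 1. *)
Definition risk_path (x : int) (c : nat -> nat) (n : nat) : int :=
  x + n%:Z - \sum_(i < n) (c i)%:Z.

Definition excess (b : nat) (y : int) : int := Num.max (y - b%:Z) 0.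

(* The reflected process, frozen from the ruin time on. *)
Fixpoint refl_path (b : nat) (x : int) (c : nat -> nat) (k : nat) : int :=
  if k is k'.+1 then
    let y := refl_path b x c k' in
    if y < 0 then y else y + 1 - (c k')%:Z - excess b (y + 1 - (c k')%:Z)
  else x - excess b x.

Definition dividend (b : nat) (x : int) (c : nat -> nat) (k : nat) : int :=
  if k is k'.+1 then
    let y := refl_path b x c k' in
    if y < 0 then 0 else excess b (y + 1 - (c k')%:Z)
  else excess b x.

Definition cum_dividends (b : nat) (x : int) (c : nat -> nat) (k : nat) : int :=
  \sum_(i < k.+1) dividend b x c i.

Definition refl_ruin (b : nat) (x : int) (c : nat -> nat) : option nat :=
  inf_time (fun k => refl_path b x c k < 0).

(* The law P_x is realised on the space carrying the claims, by starting the
   path at x. *)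
Definition claims (R : realType) (d : measure_display) (T : measurableType d)
    (P : probability T R) (C : nat -> {RV P >-> nat}) (t : T) : nat -> nat :=
  fun i => C i t.

Definition scaleW (R : realType) (d : measure_display) (T : measurableType d)
    (P : probability T R) (C : nat -> {RV P >-> nat}) (p : nat -> R)
    (v : R) (y : int) : R :=
  if 0 <= y then
    (p 0%N * expect_on P
       (fun t => pow_time v (hit_above (risk_path 0 (claims C t)) y))
       [set t | lt_time (hit_above (risk_path 0 (claims C t)) y)
                        (hit_below (risk_path 0 (claims C t)) (-1))])^-1
  else 0.

Definition Psi (R : realType) (d : measure_display) (T : measurableType d)
    (P : probability T R) (C : nat -> {RV P >-> nat})
    (v : R) (x : int) (w : R) : R :=
  expect_on P
    (fun t => let X := risk_path x (claims C t) in
              let s := hit_below X (-1) in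
              pow_time v s * w ^ (- at_time X s))
    [set t | hit_below (risk_path x (claims C t)) (-1) != None].

(* The constant a >= 0 such that Psi_v(0, w) + a W_v(0) = 1. *)
Definition alpha (R : realType) (d : measure_display) (T : measurableType d)
    (P : probability T R) (C : nat -> {RV P >-> nat}) (p : nat -> R)
    (v w : R) : R :=
  xget 0 [set a : R | 0 <= a /\ Psi C v 0 w + a * scaleW C p v 0 = 1].

Definition scaleZ (R : realType) (d : measure_display) (T : measurableType d)
    (P : probability T R) (C : nat -> {RV P >-> nat}) (p : nat -> R)
    (v : R) (x : int) (w : R) : R :=
  Psi C v x w + alpha C p v w * scaleW C p v x.

Definition DP (R : realType) (d : measure_display) (T : measurableType d)
    (P : probability T R) (C : nat -> {RV P >-> nat})
    (v : R) (b : nat) (x : int) (w z : R) : R :=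
  expect_on P
    (fun t => let c := claims C t in
              let s := refl_ruin b x c in
              pow_time v s * w ^ (- at_time (refl_path b x c) s)
                * z ^ at_time (cum_dividends b x c) s)
    [set t | refl_ruin b x (claims C t) != None].

(* Main.v *)
Require Import Defs.
From HB Require Import structures.
From mathcomp Require Import all_boot all_order all_algebra finmap.
From mathcomp Require Import all_classical all_reals all_analysis.
From mathcomp Require Import measurable_realfun.
From mathcomp Require Import ring zify.

Set Implicit Arguments.
Unset Strict Implicit.
Unset Printing Implicit Defensive.

Import Order.TTheory GRing.Theory Num.Theory.
Import numFieldNormedType.Exports.

Local Open Scope classical_set_scope.
Local Open Scope ring_scope.

(** Write U(y, x) for E_x[v^tau_y^+; tau_y^+ < tau_{-1}^-].  Conditioning on the
first claim shows that U(y, _) on [0, y), Psi on [0, oo) and DP on [0, b] are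
solutions f of

      f(x) = v * sum_k p_k f(x + 1 - k),

called harmonic below.  In the last case the value f(b + 1) is z f(b), since one
unit above the barrier is paid out at once.  The whole argument then rests on a
maximum principle ([maximum_principle]): a function that vanishes on the negative
integers, is harmonic on [0, b] and satisfies |f(b + 1)| <= |f(b)| vanishes up
to b.  For v < 1 this is a contraction.  For v = 1 some k >= 2 has p_k > 0, and
the smallest state at which |f| is maximal would then jump, with positive
probability, to a state where |f| is smaller.

The principle is used three times.

 - Uniqueness of the two-sided exit problem gives U(y, j) = U(x, j) U(y, x) for
   j <= x <= y ([exit_above_mul]), with no appeal to the strong Markov property.
   So W(j) = W(y) U(y, j) for all j <= y, and W inherits harmonicity on [0, oo)
   from U ([scaleW_harmonic]).
 - W(b + 1) = z W(b) is impossible, because W would then vanish at b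
   ([scaleW_denom_neq0]).
 - DP and Z - a W, where a is the quotient in the formula, agree on the negative
   integers, are harmonic on [0, b], and both satisfy f(b + 1) = z f(b); so they
   agree up to b.

The probabilistic input is the first-step identity [first_step].  All three
functionals are of the form g_n(C) on the event that a stopping time equals n,
with g_n a function of the first n claims only; so their expectations are
countable sums of integrals over cylinders, and independence is only needed for
finitely many claims at a time.  *)

(** * Expectation of functionals of the claims *)

Definition scons (k : nat) (c : nat -> nat) : nat -> nat :=
  fun i => if i is j.+1 then c j else k.

Definition agree (n : nat) (c c' : nat -> nat) : Prop :=
  forall i, (i < n)%N -> c i = c' i.

Definition depends_on_first (S : Type) (n : nat) (F : (nat -> nat) -> S) : Prop :=
  forall c c', agree n c c' -> F c = F c'.

Lemma depends_on_firstS S n (F : (nat -> nat) -> S) :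
  depends_on_first n F -> depends_on_first n.+1 F.
Proof. by move=> hF c c' h; apply: hF => i /ltnW; exact: h. Qed.

Lemma depends_on_first_scons S n (F : (nat -> nat) -> S) k :
  depends_on_first n.+1 F -> depends_on_first n (F \o scons k).
Proof. by move=> hF c c' h; apply: hF => -[//|i]; exact: h. Qed.

(** The expectation of [F] under the product of [n] copies of the law [p], as
iterated series; [F] is meant to ignore all coordinates from [n] on, so the
sequence at which it is finally evaluated may be any one. *)
Fixpoint iterated_sum (R : realType) (p : nat -> R) (n : nat)
    (F : (nat -> nat) -> R) : \bar R :=
  if n is m.+1 then
    (\sum_(0 <= k <oo) (p k)%:E * iterated_sum p m (F \o scons k))%E
  else (F (fun=> 0%N))%:E.

Section first_step.
Context (R : realType) (d : measure_display) (T : measurableType d).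
Context (P : probability T R) (C : nat -> {RV P >-> nat}) (p : nat -> R).
Hypothesis p_ge0 : forall k, 0 <= p k.
Hypothesis hC : iid_with_pmf C p.

Let cylinder (m : nat) (c : nat -> nat) : set T :=
  [set t | forall i, (i < m)%N -> C i t = c i].

Let cylinderE m c :
  cylinder m c = \bigcap_(i in [set` [fset i in iota 0 m]%fset])
                   C i @^-1` [set c i].
Proof.
apply/seteqP; split => t /= h i.
  by rewrite /= !inE /= mem_iota add0n /=; exact: h.
by move=> im; apply: h => /=; rewrite !inE /= mem_iota add0n.
Qed.

Let measurable_cylinder m c : measurable (cylinder m c).
Proof.
rewrite cylinderE; apply: fin_bigcap_measurable => [|i _].
  exact: finite_fset.
exact: measurable_funPTI.
Qed.

Let prob_cylinder m c : P (cylinder m c) = (\prod_(i < m) p (c i))%:E.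
Proof.
rewrite cylinderE hC.1 //.
rewrite (perm_big (iota 0 m)) /=; last first.
  apply: uniq_perm; rewrite ?iota_uniq ?fset_uniq // => i.
  by rewrite !inE.
rewrite -(subn0 m) -/(index_iota 0 m) big_mkord subn0.
rewrite (eq_bigr (fun i : 'I_m => (p (c i))%:E)) ?prodEFin // => i _.
exact: hC.2.
Qed.

Let upd (c : nat -> nat) m k i := if i == m then k else c i.

Let cylinder_split m c : cylinder m c = \bigcup_k cylinder m.+1 (upd c m k).
Proof.
apply/seteqP; split => t /=.
  move=> h; exists (C m t) => // i; rewrite ltnS leq_eqVlt /upd.
  by case: eqP => [->|_ /=] //; exact: h.
case=> k _ h i im; have := h i (ltnW im).
by rewrite /upd ltn_eqF.
Qed.

Let trivIset_cylinder m c : trivIset setT (fun k => cylinder m.+1 (upd c m k)).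
Proof.
apply/trivIsetP => i j _ _ /eqP ij; apply/seteqP; split => // t /= [h1 h2].
apply: ij.
by have := h1 m (ltnSn m); have := h2 m (ltnSn m); rewrite /upd eqxx => -> ->.
Qed.

Let prod_upd m c k :
  \prod_(i < m.+1) p (upd c m k i) = (\prod_(i < m) p (c i)) * p k.
Proof.
rewrite big_ord_recr /= /upd eqxx; congr (_ * _).
by apply: eq_bigr => i _; rewrite ltn_eqF.
Qed.

(** Once the first [m.+1] claims are fixed, the claim number [m] may be replaced
by its value: this is the step that peels off one claim in the two inductions
below, on measurability and on the value of the integral. *)
Let shift_cylinder (F : (nat -> nat) -> R) m c k t :
  cylinder m.+1 (upd c m k) t ->
  F (fun i => C (m + i)%N t) = (F \o scons k) (fun i => C (m.+1 + i)%N t).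
Proof.
move=> h; congr F; apply/funext => -[|i] /=; last by rewrite addnS.
by have := h m (ltnSn m); rewrite /upd eqxx addn0.
Qed.

Let measurable_cylinder_fun n (F : (nat -> nat) -> R) m c :
  depends_on_first n F ->
  measurable_fun (cylinder m c) (fun t => F (fun i => C (m + i)%N t)).
Proof.
elim: n F m c => [|n IH] F m c hF.
  apply: (eq_measurable_fun (cst (F (fun=> 0%N)))) => [t _|] /=.
    exact: hF.
  exact: measurable_cst.
rewrite cylinder_split; apply/measurable_fun_bigcup => // k.
apply: (eq_measurable_fun
  (fun t => (F \o scons k) (fun i => C (m.+1 + i)%N t))) => [t /set_mem ht|].
  by rewrite -(shift_cylinder F ht).
exact/IH/depends_on_first_scons.
Qed.

Lemma iterated_sum_ge0 n (F : (nat -> nat) -> R) :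
  (forall c, 0 <= F c) -> (0 <= iterated_sum p n F)%E.
Proof.
elim: n F => [|n IH] F F0 /=; first by rewrite lee_fin.
by apply: nneseries_ge0 => k _ _; rewrite mule_ge0 ?lee_fin // IH // => c; exact: F0.
Qed.

(** The claims after time [m] are distributed as the claims from the start, and
independently of the past: integrating over one more claim splits a cylinder
into countably many, whose probabilities are products. *)
Let integral_cylinder n (F : (nat -> nat) -> R) m c :
  depends_on_first n F -> (forall c, 0 <= F c) ->
  (\int[P]_(t in cylinder m c) (F (fun i => C (m + i)%N t))%:E =
   (\prod_(i < m) p (c i))%:E * iterated_sum p n F)%E.
Proof.
elim: n F m c => [|n IH] F m c hF F0.
  rewrite (eq_integral (cst (F (fun=> 0%N))%:E)) => [|t _] /=; last first.
    by congr (_%:E); exact: hF.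
  by rewrite integral_cst // muleC; congr (_ * _)%E; exact: prob_cylinder.
rewrite [in LHS]cylinder_split ge0_integral_bigcup //; last 2 first.
- by rewrite -cylinder_split; apply/measurable_EFinP/measurable_cylinder_fun/hF.
- by move=> t _; rewrite lee_fin.
rewrite /= -nneseriesZl; last first.
  by move=> k _; rewrite mule_ge0 ?lee_fin // iterated_sum_ge0 // => ?; exact: F0.
apply: eq_eseriesr => k _.
rewrite (eq_integral
  (fun t => ((F \o scons k) (fun i => C (m.+1 + i)%N t))%:E)); last first.
  by move=> t /set_mem ht; rewrite -(shift_cylinder F ht).
rewrite IH; [|exact: depends_on_first_scons|by move=> ?; exact: F0].
by rewrite prod_upd EFinM muleA.
Qed.

Let cylinder0 c : cylinder 0 c = setT.
Proof. by apply/seteqP; split. Qed.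

Lemma integral_depends_on_first n (F : (nat -> nat) -> R) :
  depends_on_first n F -> (forall c, 0 <= F c) ->
  (\int[P]_t (F (claims C t))%:E = iterated_sum p n F)%E.
Proof.
move=> hF F0; have := integral_cylinder 0 (fun=> 0%N) hF F0.
by rewrite cylinder0 big_ord0 mul1e.
Qed.

Lemma measurable_depends_on_first n (F : (nat -> nat) -> R) :
  depends_on_first n F -> measurable_fun setT (fun t => F (claims C t)).
Proof.
by move=> hF; have := @measurable_cylinder_fun n F 0 (fun=> 0%N) hF; rewrite cylinder0.
Qed.

(** The form shared by all the functionals below: keeping the time apart from the
reward makes the part collected at time [n] a function of [n] claims. *)
Definition stopped (s : (nat -> nat) -> option nat)
    (g : nat -> (nat -> nat) -> R) (c : nat -> nat) : R :=
  if s c is Some n then g n c else 0.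

Definition stopping (s : (nat -> nat) -> option nat) : Prop :=
  forall n c c', agree n c c' -> s c = Some n -> s c' = Some n.

Lemma stoppingE s n c c' : stopping s -> agree n c c' ->
  (s c == Some n) = (s c' == Some n).
Proof.
move=> hs h; apply/eqP/eqP; first exact: hs.
by apply: hs => i im; rewrite h.
Qed.

Let stopped_at (s : (nat -> nat) -> option nat) (g : nat -> (nat -> nat) -> R)
  n c : R := if s c == Some n then g n c else 0.

Let stopped_series s g c : (forall n c, 0 <= g n c) ->
  ((stopped s g c)%:E = \sum_(0 <= n <oo) (stopped_at s g n c)%:E)%E.
Proof.
move=> g0; rewrite /stopped /stopped_at; case sc : (s c) => [n|]; last first.
  by rewrite eseries0 // => i _ _ /=.
rewrite (nneseriesD1 (n := n)) //=; last first.
  by move=> k _; rewrite lee_fin; case: ifP.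
rewrite eqxx eseries0 ?adde0 // => i _ ni.
by case: eqP => // -[ni']; rewrite ni' eqxx in ni.
Qed.

Section stopped.
Variables (s : (nat -> nat) -> option nat) (g : nat -> (nat -> nat) -> R).
Hypothesis s_stop : stopping s.
Hypothesis g_dep : forall n, depends_on_first n (g n).
Hypothesis g_ge0 : forall n c, 0 <= g n c.

Let stopped_at_ge0 n c : 0 <= stopped_at s g n c.
Proof. by rewrite /stopped_at; case: ifP. Qed.

Let stopped_at_dep n : depends_on_first n (stopped_at s g n).
Proof.
by move=> c c' h; rewrite /stopped_at (stoppingE s_stop h) (g_dep h).
Qed.

Lemma measurable_stopped :
  measurable_fun setT (fun t => stopped s g (claims C t)).
Proof.
apply/measurable_EFinP; rewrite /comp.
under eq_fun do rewrite stopped_series //.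
apply: ge0_emeasurable_sum => [n t _ _|n _]; first by rewrite lee_fin.
apply/measurable_EFinP; exact: measurable_depends_on_first (stopped_at_dep (n := n)).
Qed.

Let integral_stopped_series (h : (nat -> nat) -> nat -> nat) :
  (forall n, depends_on_first n (stopped_at s g n \o h)) ->
  (\int[P]_t (stopped s g (h (claims C t)))%:E =
   \sum_(0 <= n <oo) \int[P]_t (stopped_at s g n (h (claims C t)))%:E)%E.
Proof.
move=> hdep.
under eq_integral do rewrite stopped_series //.
rewrite integral_nneseries // => n.
- by apply/measurable_EFinP; exact: measurable_depends_on_first (hdep n).
- by move=> t _; rewrite lee_fin.
Qed.

(** Split the functional according to the time [n] of collection.  The part
collected at time [n] depends on [n] claims, hence on [n.+1] claims, and
integrating out the first of them is one unfolding of [iterated_sum]; summing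
over [n] again is an interchange of nonnegative series. *)
Lemma first_step :
  (\int[P]_t (stopped s g (claims C t))%:E =
   \sum_(0 <= k <oo) (p k)%:E * \int[P]_t (stopped s g (scons k (claims C t)))%:E)%E.
Proof.
have dep_scons k n : depends_on_first n (stopped_at s g n \o scons k).
  exact/depends_on_first_scons/depends_on_firstS/stopped_at_dep.
have int0 k n : (0 <= \int[P]_t (stopped_at s g n (scons k (claims C t)))%:E)%E.
  by apply: integral_ge0 => t _; rewrite lee_fin.
rewrite (integral_stopped_series (h := id)) //.
under [RHS]eq_eseriesr => k _.
  rewrite (integral_stopped_series (h := scons k)) //.
  rewrite -nneseriesZl => [|n _]; last exact: int0.
  over.
rewrite /= nneseries_interchange => [|k n]; last first.
  by rewrite mule_ge0 ?lee_fin.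
apply: eq_eseriesr => n _.
rewrite (integral_depends_on_first (n := n.+1)) //; last first.
  exact/depends_on_firstS/stopped_at_dep.
apply: eq_eseriesr => k _; congr (_ * _)%E.
by apply/esym; apply: (integral_depends_on_first (dep_scons k n)) => c /=.
Qed.

End stopped.
End first_step.

(** * Harmonic functions from expectations *)

(** Stated as the convergence of partial sums in [R], so that harmonic functions
of any sign can be combined linearly, without absolute summability. *)
Definition harmonic_at (R : realType) (p : nat -> R) (v : R) (f : int -> R)
    (x : int) : Prop :=
  series (fun k => v * (p k * f (x + 1 - k%:Z))) @ \oo --> f x.

Lemma nneseries_EFin_cvg (R : realType) (u : nat -> R) (l : R) :
  (forall k, 0 <= u k) -> (\sum_(0 <= k <oo) (u k)%:E = l%:E)%E ->
  series u @ \oo --> l.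
Proof.
move=> u0 ul.
have : (fun n => \sum_(0 <= k < n) (u k)%:E)%E @ \oo --> l%:E.
  by rewrite -ul; apply: is_cvg_nneseries => n _ _; rewrite lee_fin.
under eq_fun do rewrite sumEFin.
by move/fine_cvgP => [].
Qed.

Section mean.
Context (R : realType) (d : measure_display) (T : measurableType d).
Context (P : probability T R) (C : nat -> {RV P >-> nat}) (p : nat -> R).
Hypothesis p_ge0 : forall k, 0 <= p k.
Hypothesis hC : iid_with_pmf C p.
Variables (s : int -> (nat -> nat) -> option nat).
Variables (g : int -> nat -> (nat -> nat) -> R).
Hypothesis s_stop : forall x, stopping (s x).
Hypothesis g_dep : forall x n, depends_on_first n (g x n).
Hypothesis g01 : forall x n c, 0 <= g x n c <= 1.

Definition mean (x : int) : R :=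
  fine (\int[P]_t (stopped (s x) (g x) (claims C t))%:E)%E.

Lemma stopped01 x c : 0 <= stopped (s x) (g x) c <= 1.
Proof. by rewrite /stopped; case: (s x c) => // ; rewrite lexx ler01. Qed.

Let stopped_ge0 x c : 0 <= stopped (s x) (g x) c.
Proof. by case/andP: (stopped01 x c). Qed.

Let g_ge0 x n c : 0 <= g x n c.
Proof. by case/andP: (g01 x n c). Qed.

Let measurable_st x :
  measurable_fun setT (fun t => (stopped (s x) (g x) (claims C t))%:E).
Proof.
by apply/measurable_EFinP; exact: measurable_stopped.
Qed.

Lemma meanE x :
  ((mean x)%:E = \int[P]_t (stopped (s x) (g x) (claims C t))%:E)%E.
Proof.
rewrite /mean fineK // ge0_fin_numE; last first.
  by apply: integral_ge0 => t _; rewrite lee_fin.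
apply: (@le_lt_trans _ _ (\int[P]_t (cst 1 t))%E); last first.
  rewrite integral_cst // mul1e.
  by apply: le_lt_trans (probability_le1 P measurableT) _; exact: ltry.
apply: ge0_le_integral => //.
- by move=> t _; rewrite lee_fin.
- by move=> t _; rewrite lee_fin; case/andP: (stopped01 x (claims C t)).
Qed.

Lemma mean_ge0 x : 0 <= mean x.
Proof.
rewrite -lee_fin meanE; apply: integral_ge0 => t _; by rewrite lee_fin.
Qed.

Lemma expect_on_mean x (Y : T -> R) (A : set T) :
  (forall t, Y t * \1_A t = stopped (s x) (g x) (claims C t)) ->
  expect_on P Y A = mean x.
Proof.
move=> h; rewrite /expect_on /mean unlock; congr fine.
by apply: eq_integral => t _; rewrite -h.
Qed.

Lemma mean_cst x r : (forall c, stopped (s x) (g x) c = r) -> mean x = r.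
Proof.
move=> h; apply: EFin_inj; rewrite meanE.
under eq_integral do rewrite h.
transitivity (r%:E * P setT)%E; first exact: integral_cst.
by rewrite probability_setT mule1.
Qed.

Lemma meanZ x y r : 0 <= r ->
  (forall c, stopped (s x) (g x) c = r * stopped (s y) (g y) c) ->
  mean x = r * mean y.
Proof.
move=> r0 h; apply: EFin_inj; rewrite EFinM !meanE.
under eq_integral do rewrite h EFinM.
by rewrite ge0_integralZl // => t _; rewrite lee_fin.
Qed.

(** The first step contributes a discount factor [v] and moves the start from [x]
to [x + 1 - k]. *)
Lemma mean_harmonic v x : 0 <= v ->
  (forall k c, stopped (s x) (g x) (scons k c) =
     v * stopped (s (x + 1 - k%:Z)) (g (x + 1 - k%:Z)) c) ->
  harmonic_at p v mean x.
Proof.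
move=> v0 h; apply: nneseries_EFin_cvg => [k|].
  by rewrite !mulr_ge0 // mean_ge0.
rewrite meanE (first_step p_ge0 hC (@s_stop x) (@g_dep x) (@g_ge0 x)).
apply: eq_eseriesr => k _.
under eq_integral do rewrite h EFinM.
rewrite ge0_integralZl ?lee_fin//; last by move=> t _; rewrite lee_fin.
by rewrite -meanE -!EFinM mulrCA.
Qed.

End mean.

(** * The maximum principle *)

Section maximum_principle.
Context (R : realType) (p : nat -> R) (v : R).
Hypothesis hp : is_pmf p.
Hypothesis hv : 0 < v <= 1.

Let p_ge0 k : 0 <= p k. Proof. exact: hp.1. Qed.

Lemma harmonic_atD f g x : harmonic_at p v f x -> harmonic_at p v g x ->
  harmonic_at p v (fun y => f y + g y) x.
Proof.
move=> hf hg; rewrite /harmonic_at.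
have -> : series (fun k => v * (p k * (f (x + 1 - k%:Z) + g (x + 1 - k%:Z)))) =
    (series (fun k => v * (p k * f (x + 1 - k%:Z))) +
     series (fun k => v * (p k * g (x + 1 - k%:Z))))%R.
  apply/funext => n; rewrite /series /= fctE -big_split /=.
  by apply: eq_bigr => k _; rewrite !mulrDr.
exact: cvgD.
Qed.

Lemma harmonic_atZ f r x : harmonic_at p v f x ->
  harmonic_at p v (fun y => r * f y) x.
Proof.
move=> hf; rewrite /harmonic_at.
have -> : series (fun k => v * (p k * (r * f (x + 1 - k%:Z)))) =
    (fun n => r * series (fun k => v * (p k * f (x + 1 - k%:Z))) n).
  apply/funext => n; rewrite /series /= mulr_sumr.
  by apply: eq_bigr => k _; rewrite [p k * _]mulrCA [v * _ in LHS]mulrCA.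
exact: cvgMl_tmp.
Qed.

Lemma eq_harmonic_at f g x : (forall y : int, y <= x + 1 -> f y = g y) ->
  harmonic_at p v f x -> harmonic_at p v g x.
Proof.
move=> fg; rewrite /harmonic_at -fg; last by rewrite lerDl.
suff -> : (fun k => v * (p k * g (x + 1 - k%:Z))) =
  (fun k => v * (p k * f (x + 1 - k%:Z))) by [].
by apply/funext => k; rewrite fg // gerBl.
Qed.

Lemma harmonic_at_ge f x k : harmonic_at p v f x -> (forall y : int, 0 <= f y) ->
  v * (p k * f (x + 1 - k%:Z)) <= f x.
Proof.
move=> hf f0; have /andP[/ltW v0 _] := hv.
apply: (cvgr_to_ge hf); exists k.+1 => // n /= kn.
rewrite /series /= (big_cat_nat _ (n := k.+1)) //= big_nat_recr //=.
by rewrite addrAC lerDr addr_ge0 // sumr_ge0 // => i _; rewrite !mulr_ge0.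
Qed.

Lemma sum_pmf_le1 n : \sum_(0 <= k < n) p k <= 1.
Proof.
rewrite -lee_fin -sumEFin -hp.2.
by apply: nneseries_lim_ge => k _; rewrite lee_fin.
Qed.

(** If all the mass sits on claims 0 and 1 the surplus never decreases; otherwise
a downward jump is possible. *)
Lemma pmf_jump : p 0%N + p 1%N != 1 -> exists2 k, (1 < k)%N & 0 < p k.
Proof.
move=> /eqP h; apply: contrapT => nk; apply: h; apply: EFin_inj.
rewrite -hp.2 (nneseries_split 0 2) ; last by move=> k _; rewrite lee_fin.
rewrite eseries0 ?adde0; last first.
  move=> k k2 _; congr (_%:E); apply/eqP; rewrite eq_le p_ge0 andbT leNgt.
  by apply/negP => pk; apply: nk; exists k.
by rewrite add0n sumEFin big_mkord !big_ord_recr big_ord0 /= add0r.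
Qed.

Lemma harmonic_at_norm_le f x M : harmonic_at p v f x -> 0 <= M ->
  (forall y : int, y <= x + 1 -> `|f y| <= M) ->
  `|f x| <= v * M.
Proof.
move=> hf M0 fM; have /andP[/ltW v0 _] := hv.
apply: (cvgr_to_le (cvg_norm hf)); near=> n.
apply: (le_trans (ler_norm_sum _ _ _)).
apply: (@le_trans _ _ (\sum_(0 <= k < n) (v * M) * p k)).
  apply: ler_sum => k _; rewrite !normrM (ger0_norm v0) (ger0_norm (p_ge0 k)).
  by rewrite -mulrA ler_wpM2l // mulrC ler_wpM2r // fM // gerBl.
by rewrite -mulr_sumr ler_piMr ?mulr_ge0 ?sum_pmf_le1.
Unshelve. all: by end_near.
Qed.

(** A single jump [k] of positive probability into a state where [f] is below the
bound makes the inequality strict, by the fixed amount [delta] in every partial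
sum from [k.+1] terms on. *)
Lemma harmonic_at_norm_lt f x M k : harmonic_at p v f x -> 0 <= M ->
  (forall y : int, y <= x + 1 -> `|f y| <= M) ->
  0 < p k -> `|f (x + 1 - k%:Z)| < M ->
  `|f x| < M.
Proof.
move=> hf M0 fM pk fk; have /andP[v_gt0 v1] := hv.
have v0 := ltW v_gt0.
pose delta := v * p k * (M - `|f (x + 1 - k%:Z)|).
have delta_gt0 : 0 < delta by rewrite !mulr_gt0 // subr_gt0.
suff : `|f x| <= M - delta by move/le_lt_trans; apply; rewrite gtrBl.
apply: (cvgr_to_le (cvg_norm hf)); exists k.+1 => // n /= kn.
apply: (le_trans (ler_norm_sum _ _ _)).
have split_k (u : nat -> R) : \sum_(0 <= i < n) u i =
    u k + \sum_(0 <= i < n | i != k) u i.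
  by rewrite (bigD1_seq k) //= ?mem_index_iota ?iota_uniq.
apply: (@le_trans _ _ (\sum_(0 <= i < n) (v * M) * p i - delta)).
  rewrite !split_k [leRHS]addrAC lerD //.
    rewrite /delta !normrM (ger0_norm v0) (ger0_norm (p_ge0 k)).
    rewrite [leRHS](_ : _ = v * (p k * `|f (x + 1 - k%:Z)|)) //.
    by rewrite /delta; ring.
  apply: ler_sum => i _; rewrite !normrM (ger0_norm v0) (ger0_norm (p_ge0 i)).
  by rewrite -mulrA ler_wpM2l // mulrC ler_wpM2r // fM // gerBl.
by rewrite lerD2r -mulr_sumr -mulrA mulrCA ler_piMr // mulr_ile1 ?sum_pmf_le1 ?sumr_ge0.
Qed.

(** The last hypothesis on [f] extends the bound of [|f|] on [0, b] to [b + 1],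
the only state above [b] that can be reached in one step.  For [v < 1] the
maximum [M] satisfies [M <= v M].  For [v = 1], take the smallest state [n] where
it is attained and a claim [k >= 2] of positive probability: at [n + 1 - k < n]
the function is strictly below [M], hence also at [n], a contradiction. *)
Lemma maximum_principle (f : int -> R) (b : nat) :
  ~ (p 0%N + p 1%N = 1 /\ v = 1) ->
  (forall y : int, y < 0 -> f y = 0) ->
  (forall y : int, 0 <= y <= b%:Z -> harmonic_at p v f y) ->
  `|f (b%:Z + 1)| <= `|f b%:Z| ->
  forall y : int, y <= b%:Z -> f y = 0.
Proof.
move=> hnot f_neg f_harm f_b y yb.
have /andP[v_gt0 v1] := hv.
have [i0 i0b f_max] : exists2 i0 : nat, (i0 <= b)%N &
    forall i : nat, (i <= b)%N -> `|f i%:Z| <= `|f i0%:Z|.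
  pose i0 : 'I_b.+1 := [arg max_(i > ord0) `|f (i : nat)%:Z|]%O.
  exists i0 => [|i]; first by rewrite -ltnS.
  rewrite -ltnS => ib; rewrite /i0; case: arg_maxP => //= m _ hm.
  exact: (hm (Ordinal ib)).
pose M := `|f i0%:Z|.
have fM (j : int) : j <= b%:Z + 1 -> `|f j| <= M.
  case: j => [j|j] jb; last by rewrite f_neg // normr0 /M.
  have [jb'|jb'] := leqP j b; first exact: f_max.
  have -> : Posz j = b%:Z + 1 by lia.
  exact/(le_trans f_b)/f_max.
suff M0 : M = 0.
  by apply/eqP; rewrite -normr_le0 -M0 fM //; lia.
have [//|Mn0] := eqVneq M 0.
have M_gt0 : 0 < M by rewrite lt0r Mn0 /M normr_ge0.
have [v_eq1|v_neq1] := eqVneq v 1; last first.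
  have hM : M <= v * M.
    apply: harmonic_at_norm_le (ltW M_gt0) _; first by apply: f_harm; lia.
    by move=> j hj; apply: fM; lia.
  have : v * M < M by rewrite gtr_pMl // lt_neqAle v_neq1.
  by rewrite ltNge hM.
have /pmf_jump[k k1 pk] : p 0%N + p 1%N != 1 by apply/eqP => ?; apply: hnot.
have hex : exists n, (n <= b)%N && (`|f n%:Z| == M).
  by exists i0; rewrite i0b eqxx.
case: (ex_minnP hex) => n /andP[nb /eqP fn] n_min.
have : `|f n%:Z| < M; last by rewrite fn ltxx.
apply: (harmonic_at_norm_lt (k := k) _ (ltW M_gt0)) => //.
- by apply: f_harm; lia.
- by move=> j hj; apply: fM; lia.
- case E : (n%:Z + 1 - k%:Z) => [j|j]; last by rewrite f_neg // normr0.
  rewrite lt_neqAle fM; last by lia.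
  rewrite andbT; apply/negP => fj.
  have : (n <= j)%N by apply: n_min; rewrite fj andbT; lia.
  lia.
Qed.

End maximum_principle.

(** * First times and paths after the first step *)

Lemma inf_timeP (A : pred nat) n :
  inf_time A = Some n <-> A n /\ forall m, (m < n)%N -> ~~ A m.
Proof.
rewrite /inf_time; case: pselect => [exA|nA]; last first.
  by split=> // -[An _]; exfalso; apply: nA; exists n.
case: ex_minnP => k Ak k_min; split=> [[<-]|[An n_min]].
  by split=> // m mk; apply/negP => /k_min; rewrite leqNgt mk.
congr Some; apply/eqP; rewrite eqn_leq k_min //= leqNgt.
by apply/negP => /n_min; rewrite Ak.
Qed.

Lemma inf_timeN (A : pred nat) :
  inf_time A = None <-> forall m, ~~ A m.
Proof.
rewrite /inf_time; case: pselect => [exA|nA]; split => //.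
  by case: exA => n An h; have := h n; rewrite An.
by move=> _ m; apply/negP => Am; apply: nA; exists m.
Qed.

Lemma eq_inf_time (A B : pred nat) : A =1 B -> inf_time A = inf_time B.
Proof. by move=> /funext ->. Qed.

Lemma inf_time0 (A : pred nat) : A 0%N -> inf_time A = Some 0%N.
Proof. by move=> A0; apply/inf_timeP. Qed.

Lemma inf_timeS (A : pred nat) : ~~ A 0%N ->
  inf_time A = omap S (inf_time (fun n => A n.+1)).
Proof.
move=> A0; case E : (inf_time (fun n => A n.+1)) => [n|] /=.
  move/inf_timeP: E => [An n_min]; apply/inf_timeP; split=> // -[//|m].
  exact: n_min.
by move/inf_timeN: E => E; apply/inf_timeN => -[|m].
Qed.

Lemma stopping_inf_time (A : (nat -> nat) -> pred nat) :
  (forall n, depends_on_first n (A ^~ n)) ->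
  stopping (fun c => inf_time (A c)).
Proof.
move=> A_dep n c c' h /inf_timeP[An n_min]; apply/inf_timeP; split.
  by rewrite -(A_dep n _ _ h).
move=> m mn; rewrite -(A_dep m c c') ?n_min // => i im.
exact/h/(ltn_trans im).
Qed.

Definition time_before (s t : option nat) : option nat :=
  if lt_time s t then s else None.

Lemma time_beforeP (A B : pred nat) n :
  time_before (inf_time A) (inf_time B) = Some n <->
  [/\ A n, forall m, (m < n)%N -> ~~ A m & forall m, (m <= n)%N -> ~~ B m].
Proof.
rewrite /time_before; split=> [|[An n_min Bn]].
  case EA : (inf_time A) => [k|] //=.
  case EB : (inf_time B) => [l|] /=.
    case: ifP => // kl [<-]; move/inf_timeP: EA => [? ?]; split => // m mk.
    by move/inf_timeP: EB => [_]; apply; exact: leq_ltn_trans kl.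
  move=> [<-]; move/inf_timeP: EA => [? ?]; split => // m _.
  by move/inf_timeN: EB.
have -> : inf_time A = Some n by apply/inf_timeP.
case EB : (inf_time B) => [l|] //=; case: ifP => // /negbT; rewrite -leqNgt => ln.
by move/inf_timeP: EB => [Bl _]; have := Bn _ ln; rewrite Bl.
Qed.

(** Whether [A] happens first at time [n], before [B], can be read off both
processes up to time [n]. *)
Lemma stopping_time_before (A B : (nat -> nat) -> pred nat) :
  (forall n, depends_on_first n (A ^~ n)) ->
  (forall n, depends_on_first n (B ^~ n)) ->
  stopping (fun c => time_before (inf_time (A c)) (inf_time (B c))).
Proof.
move=> A_dep B_dep n c c' h /time_beforeP[An n_min Bn]; apply/time_beforeP.
have h' m : (m <= n)%N -> agree m c c' by move=> mn i im; exact/h/(leq_trans im).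
split=> [|m mn|m mn]; first by rewrite -(A_dep n _ _ h).
- by rewrite -(A_dep m _ _ (h' m (ltnW mn))) n_min.
- by rewrite -(B_dep m _ _ (h' m mn)) Bn.
Qed.

Lemma time_beforeS s t :
  time_before (omap S s) (omap S t) = omap S (time_before s t).
Proof. by case: s t => [m|] [n|] //=; rewrite /time_before /= ltnS; case: ifP. Qed.

Lemma risk_path0 x c : risk_path x c 0 = x.
Proof. by rewrite /risk_path big_ord0 subr0 addr0. Qed.

Lemma risk_path_scons x k c n :
  risk_path x (scons k c) n.+1 = risk_path (x + 1 - k%:Z) c n.
Proof.
rewrite /risk_path big_ord_recl intS (eq_bigr (fun i : 'I_n => (c i)%:Z)) //=.
by lia.
Qed.

Lemma risk_path_dep x n : depends_on_first n (risk_path x ^~ n).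
Proof.
move=> c c' h; rewrite /risk_path; congr (_ - _).
by apply: eq_bigr => i _; rewrite h.
Qed.

Lemma refl_path_dep b x n : depends_on_first n (refl_path b x ^~ n).
Proof.
elim: n => [//|n IH] c c' h /=.
by rewrite (IH c c') ?h // => i /ltnW; exact: h.
Qed.

Lemma dividend_dep b x n : depends_on_first n (dividend b x ^~ n).
Proof.
case: n => [//|n] c c' h /=.
have -> : refl_path b x c n = refl_path b x c' n.
  by apply: refl_path_dep => i /ltnW; exact: h.
by rewrite h.
Qed.

Lemma cum_dividends_dep b x n : depends_on_first n (cum_dividends b x ^~ n).
Proof.
move=> c c' h; apply: eq_bigr => -[i /= in1] _; apply: dividend_dep => j ji.
by apply: h; exact: leq_trans ji _.
Qed.

Lemma excess_below b x : x <= b%:Z -> excess b x = 0.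
Proof. by move=> xb; apply/max_idPr; rewrite subr_le0. Qed.

Lemma excess_above b x : b%:Z <= x -> excess b x = x - b%:Z.
Proof. by move=> xb; apply/max_idPl; rewrite subr_ge0. Qed.

(** From [x <= b] no dividend is paid at time 0, and the initial dividend of the
process started at [x + 1 - k] is the one paid at time 1. *)
Lemma refl_path_scons b x k c n : 0 <= x <= b%:Z ->
  refl_path b x (scons k c) n.+1 = refl_path b (x + 1 - k%:Z) c n.
Proof.
move=> /andP[x0 xb]; elim: n => [|n IH].
  by rewrite /= excess_below // subr0 ltNge x0.
by rewrite [LHS]/= -/(refl_path b x (scons k c) n.+1) IH.
Qed.

Lemma dividend_scons b x k c n : 0 <= x <= b%:Z ->
  dividend b x (scons k c) n.+1 = dividend b (x + 1 - k%:Z) c n.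
Proof.
move=> xb; case: n => [|n].
  by case/andP: xb => x0 xb; rewrite /= excess_below // subr0 ltNge x0.
by rewrite [LHS]/= -/(refl_path b x (scons k c) n.+1) refl_path_scons.
Qed.

Lemma cum_dividends_scons b x k c n : 0 <= x <= b%:Z ->
  cum_dividends b x (scons k c) n.+1 = cum_dividends b (x + 1 - k%:Z) c n.
Proof.
move=> xb; rewrite /cum_dividends big_ord_recl /=.
case/andP: (xb) => _ xb'; rewrite excess_below // add0r.
by apply: eq_bigr => i _; exact: dividend_scons.
Qed.

(** The excess over the barrier is paid out at time 0; from then on the process
is the one started at the barrier. *)
Lemma refl_path_above b x c n : b%:Z <= x ->
  refl_path b x c n = refl_path b b%:Z c n.
Proof.
move=> xb; elim: n => [|n IH] /=; last by rewrite IH.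
by rewrite excess_above // excess_below //; lia.
Qed.

Lemma cum_dividends_above b x c n : b%:Z <= x ->
  cum_dividends b x c n = x - b%:Z + cum_dividends b b%:Z c n.
Proof.
move=> xb; rewrite /cum_dividends !big_ord_recl /= excess_above //.
rewrite [excess b b]excess_below // add0r; congr (_ + _).
by apply: eq_bigr => i _ /=; rewrite refl_path_above.
Qed.

Lemma cum_dividends_ge0 b x c n : 0 <= cum_dividends b x c n.
Proof.
apply: sumr_ge0 => -[[|i] /= _] _; first by rewrite le_max lexx orbT.
by case: ifP => // _; rewrite le_max lexx orbT.
Qed.

(** * The three functionals of the surplus process *)

Lemma stopped_scons (R : realType) (v : R) s s' (g g' : nat -> (nat -> nat) -> R) k c :
  s (scons k c) = omap S (s' c) ->
  (forall n, g n.+1 (scons k c) = v * g' n c) ->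
  stopped s g (scons k c) = v * stopped s' g' c.
Proof.
by move=> h hg; rewrite /stopped h; case: (s' c) => [n|] /=; rewrite ?mulr0.
Qed.

Lemma exprz_opp_absz (R : realType) (w : R) (y : int) :
  y <= 0 -> w ^ (- y) = w ^+ `|y|.
Proof. by move=> y0; rewrite exprnP; congr (w ^ _); lia. Qed.

Lemma exprn01 (R : realType) (r : R) n : 0 < r <= 1 -> 0 <= r ^+ n <= 1.
Proof. by case/andP=> r0 r1; rewrite exprn_ge0 ?exprn_ile1 // ltW. Qed.

Lemma mulr01 (R : realType) (r r' : R) :
  0 <= r <= 1 -> 0 <= r' <= 1 -> 0 <= r * r' <= 1.
Proof. by case/andP=> ? ? /andP[? ?]; rewrite mulr_ge0 ?mulr_ile1. Qed.

Section exit_above.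
Context (R : realType) (d : measure_display) (T : measurableType d).
Context (P : probability T R) (C : nat -> {RV P >-> nat}) (p : nat -> R).
Hypothesis hp : is_pmf p.
Hypothesis hC : iid_with_pmf C p.
Variable v : R.
Hypothesis hv : 0 < v <= 1.

Let p_ge0 k : 0 <= p k. Proof. exact: hp.1. Qed.

Let v_ge0 : 0 <= v. Proof. by case/andP: hv => /ltW. Qed.

(** [exit_above y x] is [E_x[v^tau_y^+; tau_y^+ < tau_{-1}^-]]: [exit_time] is
[tau_y^+] on that event and infinite off it. *)
Definition exit_time (y x : int) (c : nat -> nat) : option nat :=
  time_before (hit_above (risk_path x c) y) (hit_below (risk_path x c) (-1)).

Definition exit_gain (x : int) (n : nat) (c : nat -> nat) : R := v ^+ n.

Definition exit_above (y : int) : int -> R := mean C (exit_time y) exit_gain.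

Let exit_stop y x : stopping (exit_time y x).
Proof.
by apply: stopping_time_before => n c c' h; rewrite (risk_path_dep x h).
Qed.

Let exit_dep x n : depends_on_first n (exit_gain x n).
Proof. by []. Qed.

Let exit01 x n c : 0 <= exit_gain x n c <= 1.
Proof. exact: exprn01. Qed.

Lemma exit_above_ge0 y x : 0 <= exit_above y x.
Proof. exact: mean_ge0. Qed.

Lemma exit_above_neg y x : x < 0 -> exit_above y x = 0.
Proof.
move=> x0; apply: mean_cst => // c; rewrite /stopped /exit_time.
rewrite /time_before [hit_below _ _]inf_time0 ?risk_path0; last by lia.
by case: (hit_above _ _).
Qed.

Lemma exit_above_refl y : 0 <= y -> exit_above y y = 1.
Proof.
move=> y0; apply: mean_cst => // c; rewrite /stopped /exit_time.
suff -> : time_before (hit_above (risk_path y c) y)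
  (hit_below (risk_path y c) (-1)) = Some 0%N by [].
apply/time_beforeP; rewrite !risk_path0 lexx; split => // -[|//] _.
by rewrite risk_path0; lia.
Qed.

Lemma exit_above_harmonic y x : 0 <= x < y ->
  harmonic_at p v (exit_above y) x.
Proof.
move=> /andP[x0 xy]; apply: (mean_harmonic p_ge0 hC) => // k c.
apply: stopped_scons => [|n]; last exact: exprS.
rewrite -time_beforeS; congr time_before; rewrite [LHS]inf_timeS.
- by congr omap; apply: eq_inf_time => n; rewrite risk_path_scons.
- by rewrite risk_path0 -ltNge.
- by congr omap; apply: eq_inf_time => n; rewrite risk_path_scons.
- by rewrite risk_path0; lia.
Qed.

Lemma scaleWE y : 0 <= y -> scaleW C p v y = (p 0%N * exit_above y 0)^-1.
Proof.
move=> y0; rewrite /scaleW y0; congr (_ * _)^-1.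
apply: expect_on_mean => t; rewrite /stopped /exit_time /time_before indicE.
case: (boolP (lt_time _ _)) => h.
  rewrite mem_set // mulr1 /pow_time; move: h.
  by case: (hit_above _ _).
by rewrite memNset ?mulr0 //; exact/negP.
Qed.

End exit_above.

Section ruin.
Context (R : realType) (d : measure_display) (T : measurableType d).
Context (P : probability T R) (C : nat -> {RV P >-> nat}) (p : nat -> R).
Hypothesis hp : is_pmf p.
Hypothesis hC : iid_with_pmf C p.
Variables v w : R.
Hypotheses (hv : 0 < v <= 1) (hw : 0 < w <= 1).

Let p_ge0 k : 0 <= p k. Proof. exact: hp.1. Qed.

Let v_ge0 : 0 <= v. Proof. by case/andP: hv => /ltW. Qed.

(** At ruin the surplus is negative, so that [w^(-X)] is the natural power
[w^|X|], which is between 0 and 1 on all paths, ruined or not. *)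
Definition ruin_gain (x : int) (n : nat) (c : nat -> nat) : R :=
  v ^+ n * w ^+ `|risk_path x c n|.

Let ruin_stop x : stopping (fun c => hit_below (risk_path x c) (-1)).
Proof.
by apply: stopping_inf_time => n c c' h; rewrite (risk_path_dep x h).
Qed.

Let ruin_dep x n : depends_on_first n (ruin_gain x n).
Proof. by move=> c c' h; rewrite /ruin_gain (risk_path_dep x h). Qed.

Let ruin01 x n c : 0 <= ruin_gain x n c <= 1.
Proof. by apply: mulr01; exact: exprn01. Qed.

Lemma PsiE x : Psi C v x w =
  mean C (fun x c => hit_below (risk_path x c) (-1)) ruin_gain x.
Proof.
apply: expect_on_mean => t; rewrite /stopped indicE.
case E : (hit_below _ _) => [n|]; last first.
  by rewrite memNset ?mulr0 //= E.
rewrite mem_set /= ?E // mulr1 /pow_time /at_time /= exprz_opp_absz //.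
by move/inf_timeP: E => [/= h _]; lia.
Qed.

Lemma Psi_neg x : x < 0 -> Psi C v x w = w ^+ `|x|.
Proof.
move=> x0; rewrite PsiE; apply: mean_cst => // c.
rewrite /stopped [hit_below _ _]inf_time0 ?risk_path0; last by lia.
by rewrite /ruin_gain risk_path0 expr0 mul1r.
Qed.

Lemma Psi_harmonic x : 0 <= x -> harmonic_at p v (fun y => Psi C v y w) x.
Proof.
move=> x0; apply: (eq_harmonic_at (fun y _ => esym (PsiE y))).
apply: (mean_harmonic p_ge0 hC) => // k c; apply: stopped_scons => [|n].
  rewrite [LHS]inf_timeS; last by rewrite risk_path0; lia.
  by congr omap; apply: eq_inf_time => n; rewrite risk_path_scons.
by rewrite /ruin_gain risk_path_scons exprS mulrA.
Qed.

End ruin.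

Section dividends.
Context (R : realType) (d : measure_display) (T : measurableType d).
Context (P : probability T R) (C : nat -> {RV P >-> nat}) (p : nat -> R).
Hypothesis hp : is_pmf p.
Hypothesis hC : iid_with_pmf C p.
Variables (b : nat) (v w z : R).
Hypotheses (hv : 0 < v <= 1) (hw : 0 < w <= 1) (hz : 0 < z <= 1).

Let p_ge0 k : 0 <= p k. Proof. exact: hp.1. Qed.

Let v_ge0 : 0 <= v. Proof. by case/andP: hv => /ltW. Qed.

Definition dividend_gain (x : int) (n : nat) (c : nat -> nat) : R :=
  v ^+ n * w ^+ `|refl_path b x c n| * z ^+ `|cum_dividends b x c n|.

Let expr_cum_dividends x c n :
  z ^+ `|cum_dividends b x c n| = z ^ cum_dividends b x c n.
Proof. by rewrite exprnP gez0_abs ?cum_dividends_ge0. Qed.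

Let dividend_stop x : stopping (refl_ruin b x).
Proof.
by apply: stopping_inf_time => n c c' h; rewrite (refl_path_dep b x h).
Qed.

Let dividend_dep x n : depends_on_first n (dividend_gain x n).
Proof.
move=> c c' h.
by rewrite /dividend_gain (refl_path_dep b x h) (cum_dividends_dep b x h).
Qed.

Let dividend01 x n c : 0 <= dividend_gain x n c <= 1.
Proof. by apply: mulr01; [apply: mulr01|]; exact: exprn01. Qed.

Lemma DPE x : DP C v b x w z = mean C (refl_ruin b) dividend_gain x.
Proof.
apply: expect_on_mean => t; rewrite /stopped indicE.
case E : (refl_ruin _ _ _) => [n|]; last first.
  by rewrite memNset ?mulr0 //= E.
rewrite mem_set /= ?E // mulr1 /pow_time /at_time /= exprz_opp_absz //.
  by rewrite /dividend_gain expr_cum_dividends.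
by move/inf_timeP: E => [/= h _]; exact: ltW.
Qed.

Lemma DP_neg x : x < 0 -> DP C v b x w z = w ^+ `|x|.
Proof.
move=> x0; rewrite DPE; apply: mean_cst => // c.
have e0 : excess b x = 0 by apply: excess_below; lia.
rewrite /stopped [refl_ruin _ _ _]inf_time0 /= ?e0 ?subr0 //.
rewrite /dividend_gain /cum_dividends big_ord1 /= e0 subr0.
by rewrite !expr0 mul1r mulr1.
Qed.

(** At [x = b], claim [k = 0] leads to the start [b + 1], where the process pays
out one unit immediately, as does the process at [b] upon a period without
claim. *)
Lemma DP_harmonic x : 0 <= x <= b%:Z ->
  harmonic_at p v (fun y => DP C v b y w z) x.
Proof.
move=> xb; apply: (eq_harmonic_at (fun y _ => esym (DPE y))).
apply: (mean_harmonic p_ge0 hC) => // k c; apply: stopped_scons => [|n].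
  rewrite [LHS]inf_timeS; last first.
    by case/andP: xb => x0 xb; rewrite /= excess_below // subr0 -leNgt.
  by congr omap; apply: eq_inf_time => n; rewrite refl_path_scons.
by rewrite /dividend_gain refl_path_scons // cum_dividends_scons // exprS !mulrA.
Qed.

Lemma DP_above x : b%:Z <= x ->
  DP C v b x w z = z ^ (x - b%:Z) * DP C v b b%:Z w z.
Proof.
move=> bx; rewrite !DPE; have z_gt0 : 0 < z by case/andP: hz.
apply: meanZ => // [|c]; first by rewrite exprz_ge0 // ltW.
have ruinE : refl_ruin b x c = refl_ruin b b%:Z c.
  by apply: eq_inf_time => n; rewrite refl_path_above.
rewrite /stopped ruinE; case: (refl_ruin b b%:Z c) => [n|]; last by rewrite mulr0.
rewrite /dividend_gain refl_path_above // !expr_cum_dividends.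
rewrite cum_dividends_above //.
by rewrite expfzDr ?gt_eqF //; ring.
Qed.

End dividends.

(** * The scale function and the dividend formula *)

Section scale_function.
Context (R : realType) (d : measure_display) (T : measurableType d).
Context (P : probability T R) (C : nat -> {RV P >-> nat}) (p : nat -> R).
Variable v : R.
Hypotheses (hp : is_pmf p) (hp0 : 0 < p 0%N) (hC : iid_with_pmf C p).
Hypothesis hv : 0 < v <= 1.
Hypothesis hnot : ~ (p 0%N + p 1%N = 1 /\ v = 1).

Let W : int -> R := scaleW C p v.
Let U (y x : int) : R := exit_above C v y x.

(** [y - x] periods without claim lead from [x] to [y]. *)
Lemma exit_above_gt0 y x : 0 <= x <= y -> 0 < U y x.
Proof.
move=> /andP[x0 xy]; have /andP[v_gt0 _] := hv.
have {xy} [n ->] : exists n : nat, y = x + n%:Z by exists `|y - x|%N; lia.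
elim: n x x0 => [|n IH] x x0; first by rewrite addr0 /U exit_above_refl.
have hx : harmonic_at p v (U (x + n.+1%:Z)) x.
  by apply: (exit_above_harmonic hp hC hv); lia.
have := harmonic_at_ge hp hv 0 hx (exit_above_ge0 C hv (x + n.+1%:Z)).
apply: lt_le_trans; rewrite subr0 !mulr_gt0 // intS addrA.
by apply: IH; lia.
Qed.

(** As the surplus increases by at most one per period, [x] is passed on the way
up to [y].  Analytically: as functions of [j], both sides vanish below 0, are
harmonic on [0, x) and agree at [x], so their difference vanishes by the maximum
principle with [b = x - 1]. *)
Lemma exit_above_mul y x j : 0 <= x <= y -> j <= x ->
  U y j = U x j * U y x.
Proof.
move=> /andP[x0 xy] jx; have [j0|j0] := ltP j 0.
  by rewrite /U !(exit_above_neg C hv _ j0) // mul0r.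
have [->|jx'] := eqVneq j x; first by rewrite [U x x]exit_above_refl // mul1r.
have [b xE] : exists b : nat, x = b%:Z + 1 by exists `|x - 1|%N; lia.
pose f i := U y i + (- U y x) * U x i.
suff : f j = 0 by rewrite /f => /eqP; rewrite mulNr subr_eq0 mulrC => /eqP.
apply: (maximum_principle (b := b) hp hv hnot); last by lia.
- by move=> i i0; rewrite /f /U !(exit_above_neg C hv _ i0) // mulr0 addr0.
- move=> i ib; apply: harmonic_atD.
    by apply: (exit_above_harmonic hp hC hv); lia.
  by apply: harmonic_atZ; apply: (exit_above_harmonic hp hC hv); lia.
- by rewrite -xE /f [U x x]exit_above_refl // mulr1 subrr normr0.
Qed.

Lemma scaleW_neg x : x < 0 -> W x = 0.
Proof. by rewrite /W /scaleW ltNge; case: (0 <= x). Qed.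

Lemma scaleW_gt0 x : 0 <= x -> 0 < W x.
Proof.
by move=> x0; rewrite /W scaleWE // invr_gt0 mulr_gt0 // exit_above_gt0 // lexx.
Qed.

(** This is [exit_above_mul] started at 0, where [W y = (p_0 U y 0)^-1]. *)
Lemma scaleW_exit_above y j : 0 <= y -> j <= y -> W j = W y * U y j.
Proof.
move=> y0 jy; have [j0|j0] := ltP j 0.
  by rewrite scaleW_neg // /U (exit_above_neg C hv _ j0) // mulr0.
rewrite /W !scaleWE // -!/(U _ _) (exit_above_mul (y := y) (x := j) (j := 0)) ?j0 //.
have : U y j != 0 by rewrite gt_eqF // exit_above_gt0 // j0.
have : U j 0 != 0 by rewrite gt_eqF // exit_above_gt0 // lexx.
have : p 0%N != 0 by rewrite gt_eqF.
by move=> *; field; apply/and3P.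
Qed.

(** All the states that can be reached from [x] in one step are at most [x + 1],
and up to there [W] is a multiple of [U (x + 1)], harmonic at [x]. *)
Lemma scaleW_harmonic x : 0 <= x -> harmonic_at p v W x.
Proof.
move=> x0.
apply: (eq_harmonic_at (f := fun j => W (x + 1) * U (x + 1) j)) => [j jx|].
  by rewrite -scaleW_exit_above //; lia.
by apply: harmonic_atZ; apply: (exit_above_harmonic hp hC hv); lia.
Qed.

(** If the denominator vanished, [W] itself would satisfy the hypotheses of the
maximum principle, contradicting [W b > 0]. *)
Lemma scaleW_denom_neq0 (b : nat) z : 0 < z <= 1 ->
  W (b%:Z + 1) - z * W b%:Z != 0.
Proof.
move=> /andP[z0 z1]; apply/negP; rewrite subr_eq0 => /eqP Wb.
have := scaleW_gt0 (le0z_nat b); rewrite (_ : W b%:Z = 0) ?ltxx //.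
apply: (maximum_principle (b := b) hp hv hnot) => //.
- exact: scaleW_neg.
- by move=> y /andP[y0 _]; exact: scaleW_harmonic.
- by rewrite Wb normrM (gtr0_norm z0) ler_piMl.
Qed.

End scale_function.

Theorem proposition35 (R : realType) (d : measure_display)
    (T : measurableType d) (P : probability T R)
    (C : nat -> {RV P >-> nat}) (p : nat -> R)
    (hp : is_pmf p) (hp0 : 0 < p 0%N) (hC : iid_with_pmf C p)
    (b : nat) (v w z : R)
    (hv : 0 < v <= 1) (hw : 0 < w <= 1) (hz : 0 < z <= 1)
    (hnot : ~ (p 0%N + p 1%N = 1 /\ v = 1))
    (x : int) :
  DP C v b x w z =
    if x <= b%:Z then
      scaleZ C p v x w
      - (scaleZ C p v (b%:Z + 1) w - z * scaleZ C p v b%:Z w)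
        / (scaleW C p v (b%:Z + 1) - z * scaleW C p v b%:Z)
        * scaleW C p v x
    else z ^ (x - b%:Z) * DP C v b b%:Z w z.
Proof.
case: (leP x b%:Z) => [xb|/ltW bx]; last exact: DP_above.
set a := _ / _.
have Wb_neq0 := scaleW_denom_neq0 hp hp0 hC hv hnot b hz.
(* With Z = Psi + alpha W, this is DP - (Z - a W). *)
pose f y := DP C v b y w z
  + (-1 * Psi C v y w + (a - alpha C p v w) * scaleW C p v y).
suff : f x = 0.
  move=> /eqP; rewrite /f addr_eq0 => /eqP ->; rewrite /scaleZ; ring.
apply: (maximum_principle (b := b) hp hv hnot) => //.
- move=> y y0; rewrite /f DP_neg // Psi_neg // scaleW_neg //.
  by rewrite mulN1r mulr0 addr0 subrr.
- move=> y yb; have /andP[y0 _] := yb; apply: harmonic_atD.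
    exact: DP_harmonic.
  apply: harmonic_atD; apply: harmonic_atZ; first exact: Psi_harmonic.
  exact: scaleW_harmonic.
(* The choice of [a] makes Z - a W satisfy the relation f(b + 1) = z f(b), which
   DP satisfies by [DP_above]. *)
- have -> : f (b%:Z + 1) = z * f b%:Z.
    rewrite /f DP_above ?lerDl // [b%:Z + 1]addrC addrK expr1z.
    rewrite /a /scaleZ; rewrite [1 + _]addrC; field.
    exact: Wb_neq0.
  have /andP[z0 z1] := hz.
  by rewrite normrM (gtr0_norm z0) ler_piMl.
Qed.
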